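(* Let a continuous contraction algorithm be fixed. Then: (i) there is a family of $s$-$t$-graphs, one with $n$ vertices for each $n$, on which the algorithm outputs an $s$-$t$-mincut only with a probability that is exponentially small in the number of vertices $n$; (ii) there is a family of graphs, one with $n$ vertices for each $n$, on which the algorithm outputs a normalized cut (a minimizer of the normalized cut cost) only with a probability that is exponentially small in the number of vertices $n$.
   Context: All graphs are undirected, connected, with non-negative edge weights $w$; $n=|V|$. For $A,B\subseteq V$, $w(A,B)=\sum_{a\in A,b\in B} w_{ab}$, where $w_{ab}=0$ if there is no edge. A cut is a partition $V=A\cup B$ into disjoint nonempty sets; its cost is $w(A,B)$. An $s$-$t$-graph is a graph with two distinguished vertices $s\neq t$; an $s$-$t$-cut is a cut $(S,T)$ with $s\in S$, $t\in T$, and an $s$-$t$-mincut is an $s$-$t$-cut of minimal cost. The normalized cut cost is $\mathrm{ncut}(A,B)=\frac{w(A,B)}{w(A,V)}+\frac{w(A,B)}{w(B,V)}$, and a normalized cut is a cut minimizing it. Contraction of vertices $v_1,v_2$: remove $v_1,v_2$ and their edges, add a new vertex $u$, give $u$ an edge to each $x\notin\{v_1,v_2\}$ adjacent to $v_i$ with the same weight, and merge parallel edges by adding their weights. A general contraction algorithm is specified by a score function $\mathcal{W}(e;A,s,t)\ge 0$ assigning a score to each edge $e=\{i,j\}$ of a graph with weighted adjacency matrix $A$ (and optionally seed vertices $s,t$). It proceeds: while the graph has more than 2 vertices, choose an edge $e$ of the current graph with probability proportional to $\mathcal{W}(e;A,s,t)$, where $A$ is the current weighted adjacency matrix, and contract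 it (if $s$ or $t$ is contracted with another vertex, the new vertex becomes $s$ resp. $t$). The two final vertices correspond to a cut of the original graph, which is the output. A continuous contraction algorithm is a general contraction algorithm whose score $\mathcal{W}$ is a continuous function of the adjacency matrix $A$. *)

(* Defs.v *)
From HB Require Import structures.
From mathcomp Require Import all_boot all_order all_algebra.
From mathcomp Require Import all_classical all_reals topology normedtype.

Set Implicit Arguments.
Unset Strict Implicit.
Unset Printing Implicit Defensive.

Import Order.TTheory GRing.Theory Num.Theory.
Import numFieldNormedType.Exports.

Local Open Scope ring_scope.

(* A weighted graph on the vertex set 'I_n is given by its
   weighted adjacency matrix; {a, b} is an edge iff 0 < A a b. *)
Section Graphs.
Variables (R : realType) (n : nat).
Implicit Types (A : 'M[R]_n) (S T : {set 'I_n}).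

Definition adjacent A : rel 'I_n := fun a b => 0 < A a b.

Definition is_graph A : Prop :=
  [/\ forall a b, 0 <= A a b,
      forall a b, A a b = A b a,
      forall a, A a a = 0
    & forall a b, connect (adjacent A) a b].

(* The edge {i, j} is listed once, as the pair (i, j) with i < j. *)
Definition edges A : {set 'I_n * 'I_n} :=
  [set e : 'I_n * 'I_n | (e.1 < e.2)%N && adjacent A e.1 e.2].

Definition wt A S T : R := \sum_(a in S) \sum_(b in T) A a b.

(* The cut (S, T), T = ~: S, is represented by its first side S. *)
Definition is_cut S : bool := (S != finset.set0) && (~: S != finset.set0).

Definition cut_cost A S : R := wt A S (~: S).

Definition is_st_cut (s t : 'I_n) S : bool :=
  [&& is_cut S, s \in S & t \in ~: S].

Definition is_st_mincut A (s t : 'I_n) S : bool :=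
  is_st_cut s t S &&
  [forall S' : {set 'I_n},
    is_st_cut s t S' ==> (cut_cost A S <= cut_cost A S')].

Definition ncut A S : R :=
  cut_cost A S / wt A S [set: 'I_n] + cut_cost A S / wt A (~: S) [set: 'I_n].

Definition is_normalized_cut A S : bool :=
  is_cut S && [forall S' : {set 'I_n}, is_cut S' ==> (ncut A S <= ncut A S')].

End Graphs.

Section Contraction.
Variables (R : realType) (n : nat).

(* The quotient map identifying j with i (for i != j): the label j is deleted,
   the other vertices keep their order, and the merged vertex is the image of
   i.  The default ord0 is only reached when i = j. *)
Definition merge_vertices (i j : 'I_n.+2) (x : 'I_n.+2) : 'I_n.+1 :=
  odflt (odflt ord0 (unlift j i)) (unlift j x).

(* Adding up the weights between the fibres of the quotient map merges the
   parallel edges; the contracted edge disappears since the diagonal is zeroed. *)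
Definition contract_mx (A : 'M[R]_n.+2) (i j : 'I_n.+2) : 'M[R]_n.+1 :=
  \matrix_(u, v)
    if u == v then 0
    else wt A (merge_vertices i j @^-1: [set u])
              (merge_vertices i j @^-1: [set v]).

End Contraction.

(* Optional seed vertices (s, t).  Contracting {s, t} makes the new vertex both
   s and t, so the two seeds of an intermediate graph may coincide. *)
Definition seeds (n : nat) : Type := option ('I_n * 'I_n).

Definition contract_seeds (n : nat) (i j : 'I_n.+2) (sd : seeds n.+2) :
    seeds n.+1 :=
  omap (fun st => (merge_vertices i j st.1, merge_vertices i j st.2)) sd.

(* score A sd i j is only meaningful when (i, j) is in edges A.  The positivity
   of the total score says that "a random edge with probability proportional
   to the score" exists whenever the algorithm has to choose one.  The scores
   are not assumed to be invariant under relabelling of the vertices. *)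
Record contraction_algorithm (R : realType) := ContractionAlgorithm {
  score : forall n : nat, 'M[R]_n -> seeds n -> 'I_n -> 'I_n -> R;
  score_ge0 : forall (n : nat) (A : 'M[R]_n) (sd : seeds n) (e : 'I_n * 'I_n),
    is_graph A -> e \in edges A -> 0 <= score A sd e.1 e.2;
  score_total_gt0 : forall (n : nat) (A : 'M[R]_n) (sd : seeds n),
    (2 < n)%N -> is_graph A -> 0 < \sum_(e in edges A) score A sd e.1 e.2
}.

(* For every edge slot e, the score of e is a continuous function of A on the
   set of the graphs A in which e is an edge. *)
Definition continuous_algorithm (R : realType)
    (alg : contraction_algorithm R) : Prop :=
  forall (n : nat) (sd : seeds n) (e : 'I_n * 'I_n),
    ({within [set A : 'M[R]_n | is_graph A /\ e \in edges A],
      continuous (fun A : 'M[R]_n => score alg A sd e.1 e.2)})%classic.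

Definition choice_prob (R : realType) (alg : contraction_algorithm R) (n : nat)
    (A : 'M[R]_n) (sd : seeds n) (e : 'I_n * 'I_n) : R :=
  score alg A sd e.1 e.2 / \sum_(f in edges A) score alg A sd f.1 f.2.

Definition pull_back (n : nat) (i j : 'I_n.+2) (D : {set {set 'I_n.+1}}) :
    {set {set 'I_n.+2}} :=
  [set merge_vertices i j @^-1: S | S : {set 'I_n.+1} in D].

(* output_law alg A sd C is the probability that the run started on A outputs
   the cut C = [set S; ~: S], seen as the partition of the vertices into its
   two sides.  With two vertices left, the sides are the two singletons.  The
   recursion is on the number m of contractions, i.e. on m.+2 vertices. *)
Fixpoint output_law (R : realType) (alg : contraction_algorithm R) (m : nat) :
    'M[R]_m.+2 -> seeds m.+2 -> {set {set 'I_m.+2}} -> R :=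
  match m return 'M[R]_m.+2 -> seeds m.+2 -> {set {set 'I_m.+2}} -> R with
  | 0 => fun _ _ C => (C == [set [set x] | x : 'I_2])%:R
  | k.+1 => fun A sd C =>
      \sum_(e in edges A)
        choice_prob alg A sd e *
        \sum_(D : {set {set 'I_k.+2}} | pull_back e.1 e.2 D == C)
          output_law alg (contract_mx A e.1 e.2) (contract_seeds e.1 e.2 sd) D
  end.

Definition prob_st_mincut (R : realType) (alg : contraction_algorithm R)
    (m : nat) (A : 'M[R]_m.+2) (s t : 'I_m.+2) : R :=
  \sum_(C : {set {set 'I_m.+2}} | [exists S in C, is_st_mincut A s t S])
    output_law alg A (Some (s, t)) C.

Definition prob_normalized_cut (R : realType) (alg : contraction_algorithm R)
    (m : nat) (A : 'M[R]_m.+2) : R :=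
  \sum_(C : {set {set 'I_m.+2}} | [exists S in C, is_normalized_cut A S])
    output_law alg A None C.

(* Main.v *)
(** The law of the output is continuous along weighted graphs with a fixed edge
    set.  Hence it suffices to find a graph A with exponentially many optimal
    cuts, each of which becomes the unique optimum after an arbitrarily small
    perturbation of the weights of A that keeps the edge set: the
    probabilities that the run on A outputs these cuts sum up to at most 1, so
    one of them is exponentially small, and it stays so on a graph close to A
    that has this cut as its unique optimum.
    For s-t-mincuts, A has unit weights on all the edges touching s or t, and
    the edges inside the two sides of the chosen cut are made heavier.  For
    normalized cuts, A is the complete graph with unit weights, in which all the
    cuts have the same normalized cost; the weights inside the two sides of the
    chosen cut are increased so that the graph stays regular. *)
Require Import Defs.
From mathcomp Require Import all_boot all_order all_algebra.
From mathcomp Require Import all_classical all_reals topology normedtype sequences.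
From mathcomp Require Import ring.
From mathcomp Require Import fintype finset.
(* [sequences] exports another [adjacent]. *)
Import Defs.
Import Order.TTheory GRing.Theory Num.Theory.
Import numFieldNormedType.Exports.
Set Implicit Arguments.
Unset Strict Implicit.
Unset Printing Implicit Defensive.

Local Open Scope ring_scope.

(** * Contraction of weighted graphs and their edge sets *)

Lemma merge_lift n (i j : 'I_n.+2) (u : 'I_n.+1) :
  merge_vertices i j (lift j u) = u.
Proof. by rewrite /merge_vertices liftK. Qed.

Lemma wt_ge0 (R : realType) n (A : 'M[R]_n) (S T : {set 'I_n}) :
  (forall a b, 0 <= A a b) -> 0 <= wt A S T.
Proof. by move=> A0; apply: sumr_ge0 => a _; apply: sumr_ge0. Qed.

Lemma wt_gt0 (R : realType) n (A : 'M[R]_n) (S T : {set 'I_n}) :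
  (forall a b, 0 <= A a b) ->
  (0 < wt A S T) = [exists a in S, exists b in T, 0 < A a b].
Proof.
move=> A0; apply/idP/idP => [|/exists_inP[a aS /exists_inP[b bT ab]]].
  apply: contraTT => /exists_inPn noS; rewrite -leNgt; apply: sumr_le0 => a aS.
  apply: sumr_le0 => b bT; rewrite leNgt.
  by move/exists_inPn: (noS a aS) => /(_ b bT).
rewrite /wt (bigD1 a aS) /= (bigD1 b bT) /= -addrA ltr_wpDr //.
by apply: addr_ge0; do ?[apply: sumr_ge0 => ? _].
Qed.

(** A sum of non-negative weights is positive exactly when one of them is. So the edges after a
    contraction depend only on the edges before it, not on the weights. *)
Lemma adjacent_contract (R : realType) n (A : 'M[R]_n.+2) (i j : 'I_n.+2) u v :
  (forall a b, 0 <= A a b) ->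
  adjacent (contract_mx A i j) u v =
  (u != v) && [exists a in merge_vertices i j @^-1: [set u],
                exists b in merge_vertices i j @^-1: [set v], adjacent A a b].
Proof.
move=> A0; rewrite {1}/adjacent mxE; case: eqP => [_|_] /=.
  by rewrite ltxx.
by rewrite wt_gt0.
Qed.

(** Connectedness survives because the quotient map is onto and sends a path to a path, once the
    steps inside a fibre are dropped. *)
Lemma is_graph_contract (R : realType) n (A : 'M[R]_n.+2) (i j : 'I_n.+2) :
  is_graph A -> is_graph (contract_mx A i j).
Proof.
move=> [A0 Asym _ Acon]; split => [a b|a b|a|u v].
- by rewrite mxE; case: ifP => // _; apply: wt_ge0.
- rewrite !mxE eq_sym; case: ifP => // _; rewrite /wt exchange_big /=.
  by apply: eq_bigr => x _; apply: eq_bigr => y _; apply: Asym.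
- by rewrite mxE eqxx.
have conn x y : connect (adjacent A) x y ->
    connect (adjacent (contract_mx A i j)) (merge_vertices i j x)
      (merge_vertices i j y); last first.
  by rewrite -(merge_lift i j u) -(merge_lift i j v); apply/conn/Acon.
case/connectP=> p + ->; elim: p x => [|z p IH] x //=.
case/andP => xz /IH; apply: connect_trans.
have [->|ne] := eqVneq (merge_vertices i j x) (merge_vertices i j z).
  exact: connect0.
apply: connect1; rewrite adjacent_contract // ne /=.
apply/exists_inP; exists x; first by rewrite !inE.
by apply/exists_inP; exists z; rewrite ?inE.
Qed.

Lemma eq_edges (R : realType) n (A B : 'M[R]_n) :
  adjacent A =2 adjacent B -> edges A = edges B.
Proof. by move=> AB; apply/setP => e; rewrite !inE AB. Qed.

Lemma eq_adjacent_contract (R : realType) n (A B : 'M[R]_n.+2) (i j : 'I_n.+2) :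
  is_graph A -> is_graph B -> adjacent A =2 adjacent B ->
  adjacent (contract_mx A i j) =2 adjacent (contract_mx B i j).
Proof.
move=> [A0 _ _ _] [B0 _ _ _] AB u v; rewrite !adjacent_contract //.
congr (_ && _); apply: eq_existsb => a; congr (_ && _).
by apply: eq_existsb => b; rewrite AB.
Qed.

Lemma sum_neq0 (V : nmodType) (I : finType) (P : pred I) (F : I -> V) :
  \sum_(i | P i) F i != 0 -> exists2 i, P i & F i != 0.
Proof.
case: (pickP [pred i | P i && (F i != 0)]) => [i /andP[]|F0]; first by exists i.
rewrite big1 ?eqxx // => i Pi; apply/eqP.
by have := F0 i; rewrite /= Pi => /negbFE.
Qed.

(** * The output law as a probability distribution on bipartitions *)

Section OutputLaw.
Variables (R : realType) (alg : contraction_algorithm R).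

Lemma choice_prob_ge0 n (A : 'M[R]_n) (sd : seeds n) e :
  is_graph A -> e \in edges A -> 0 <= choice_prob alg A sd e.
Proof.
move=> gA eA; rewrite divr_ge0 ?score_ge0 //.
by apply: sumr_ge0 => f fA; apply: score_ge0.
Qed.

Lemma sum_choice_prob n (A : 'M[R]_n) (sd : seeds n) :
  (2 < n)%N -> is_graph A -> \sum_(e in edges A) choice_prob alg A sd e = 1.
Proof.
move=> n2 gA; rewrite -mulr_suml divff // gt_eqF //.
exact: score_total_gt0.
Qed.

Lemma output_law_ge0 m (A : 'M[R]_m.+2) sd C :
  is_graph A -> 0 <= output_law alg A sd C.
Proof.
elim: m A sd C => [|m IH] A sd C gA /=; first exact: ler0n.
apply: sumr_ge0 => e eA; rewrite mulr_ge0 ?choice_prob_ge0 //.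
by apply: sumr_ge0 => D _; apply/IH/is_graph_contract.
Qed.

(** Each [D] has exactly one pull-back, so summing over all [C] the sums over the fibres of
    [pull_back] gives the total mass of the law on the contracted graph, which is 1 by induction. *)
Lemma sum_output_law m (A : 'M[R]_m.+2) sd :
  is_graph A -> \sum_C output_law alg A sd C = 1.
Proof.
elim: m A sd => [|m IH] A sd gA /=.
  rewrite (bigD1 [set [set x] | x : 'I_2]) //= eqxx big1 ?addr0 // => C.
  by move=> /negPf ->.
rewrite exchange_big /= -[RHS](@sum_choice_prob _ A sd) //.
apply: eq_bigr => e eA; rewrite -mulr_sumr.
rewrite -[RHS]mulr1; congr (_ * _).
rewrite -(IH (contract_mx A e.1 e.2) (contract_seeds e.1 e.2 sd)); last first.
  exact: is_graph_contract.
rewrite [RHS](partition_big (pull_back e.1 e.2) xpredT) //=.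
Qed.

(** Holds for the two singletons of a two-vertex graph, and is inherited because preimages commute
    with complements. *)
Lemma output_law_bipartition m (A : 'M[R]_m.+2) sd C :
  output_law alg A sd C != 0 -> exists S, C = [set S; ~: S].
Proof.
elim: m A sd C => [|m IH] A sd C /=.
  have [-> _|] := eqVneq C; last by rewrite eqxx.
  exists [set ord0]; apply/setP => S; rewrite !inE.
  have setC0 : ~: [set ord0] = [set ord_max] :> {set 'I_2}.
    by apply/setP => -[[|[|//]] lt2]; rewrite !inE -!val_eqE.
  apply/imsetP/orP => [[x _ ->]|].
    by case: x => -[|[|//]] lt2; [left|right; rewrite setC0];
      apply/eqP; congr [set _]; apply: val_inj.
  by case=> /eqP ->; [exists ord0|exists ord_max].
case/sum_neq0 => e _; rewrite mulf_eq0 => /norP[_].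
case/sum_neq0 => D /eqP <- /IH[S ->].
exists (merge_vertices e.1 e.2 @^-1: S).
by rewrite /pull_back imsetU !imset_set1 preimsetC.
Qed.

End OutputLaw.

(** * Convergence of matrices and perturbation of weights *)

Lemma cvg_sum (R : realType) (I : finType) (P : pred I) (f : I -> nat -> R)
    (a : I -> R) :
  (forall i, P i -> f i @ \oo --> a i)%classic ->
  ((fun k => \sum_(i | P i) f i k) @ \oo --> \sum_(i | P i) a i)%classic.
Proof. by move=> fa; apply: cvg_big => //; apply: add_continuous. Qed.

Lemma cvg_mx (R : realType) p q (u : nat -> 'M[R]_(p, q)) (A : 'M[R]_(p, q)) :
  (forall i j, (fun k => u k i j) @ \oo --> A i j)%classic ->
  (u @ \oo --> A)%classic.
Proof.
move=> uA B [P AP sPB].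
have : (\forall k \near \oo, forall i j, P i j (u k i j))%classic.
  by do 2!apply: filter_forall => ?; apply: uA.
by apply: filterS => k Pk; apply: sPB.
Qed.

Lemma cvg_contract_mx (R : realType) n (u : nat -> 'M[R]_n.+2) A (i j : 'I_n.+2) :
  (u @ \oo --> A ->
  (fun k => contract_mx (u k) i j) @ \oo --> contract_mx A i j)%classic.
Proof.
move=> uA; apply: cvg_mx => a b; rewrite mxE.
under eq_fun do rewrite mxE; case: ifP => _; first exact: cvg_cst.
rewrite /wt; apply: cvg_sum => x _; apply: cvg_sum => y _.
exact: (cvg_comp _ _ uA (@coord_continuous R _ _ x y A)).
Qed.

(** Since [P] is non-negative and vanishes wherever [A] does, no edge is created and none
    disappears. *)
Lemma is_graph_perturb (R : realType) n (A P : 'M[R]_n) (eps : R) :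
  is_graph A -> (forall a b, 0 <= P a b) -> (forall a b, P a b = P b a) ->
  (forall a b, A a b = 0 -> P a b = 0) -> 0 <= eps ->
  is_graph (A + eps *: P) /\ adjacent (A + eps *: P) =2 adjacent A.
Proof.
move=> [A0 Asym Adiag Acon] P0 Psym PA e0.
have adj : adjacent (A + eps *: P) =2 adjacent A.
  move=> a b; rewrite /adjacent !mxE; have [/[dup] /PA -> ->|nz] := eqVneq (A a b) 0.
    by rewrite mulr0 addr0.
  have Ap : 0 < A a b by rewrite lt0r nz A0.
  by rewrite Ap ltr_pwDl // mulr_ge0.
split=> //; split=> [a b|a b|a|a b].
- by rewrite !mxE addr_ge0 // mulr_ge0.
- by rewrite !mxE Asym Psym.
- by rewrite !mxE PA // Adiag mulr0 addr0.
- by rewrite (eq_connect adj).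
Qed.

(** * Continuity of the output law and unlikely cuts *)

Section Continuity.
Variables (R : realType) (alg : contraction_algorithm R).
Hypothesis hcont : continuous_algorithm alg.

Lemma cvg_score n (u : nat -> 'M[R]_n) A sd e :
  is_graph A -> (forall k, is_graph (u k)) ->
  (forall k, adjacent (u k) =2 adjacent A) -> e \in edges A ->
  (u @ \oo --> A)%classic ->
  ((fun k => score alg (u k) sd e.1 e.2) @ \oo --> score alg A sd e.1 e.2)%classic.
Proof.
move=> gA gu adj eA uA.
have /subspace_continuousP cA := @hcont n sd e.
have {}cA := cA A (conj gA eA).
move=> B /cA /uA BA.
(* Continuity is given only within the graphs that have [e] as an edge. Unfolding the relative
   neighbourhood leaves this as a side condition, which every [u k] meets. *)
have {}BA : (\forall k \near \oo, is_graph (u k) /\ e \in edges (u k) ->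
  B (score alg (u k) sd e.1 e.2))%classic by exact: BA.
apply: (@filterS _ _ _ _ _ _ BA) => k; apply; split => //.
by rewrite (eq_edges (adj k)).
Qed.

(** Induction on the number of contractions. With the edge set constant along the sequence, the law
    is a finite sum over a fixed index set, the normalizing total score has a positive limit, and
    contraction preserves both convergence and equality of edge sets. *)
Lemma cvg_output_law m (u : nat -> 'M[R]_m.+2) A sd C :
  is_graph A -> (forall k, is_graph (u k)) ->
  (forall k, adjacent (u k) =2 adjacent A) ->
  (u @ \oo --> A)%classic ->
  ((fun k => output_law alg (u k) sd C) @ \oo --> output_law alg A sd C)%classic.
Proof.
elim: m u A sd C => [|m IH] u A sd C gA gu adj uA /=; first exact: cvg_cst.
under eq_fun do rewrite (eq_edges (adj _)).
apply: cvg_sum => e eA; apply: cvgM.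
  under eq_fun do rewrite /choice_prob (eq_edges (adj _)).
  apply: cvgM; first exact: cvg_score.
  apply: cvgV; first by rewrite gt_eqF // score_total_gt0.
  by apply: cvg_sum => f fA; apply: cvg_score.
apply: cvg_sum => D _; apply: IH.
- exact: is_graph_contract.
- by move=> k; apply: is_graph_contract.
- by move=> k; apply: eq_adjacent_contract.
- exact: cvg_contract_mx.
Qed.

(** Pigeonhole on [A] gives a cut of probability at most [1 / #|F|]. The factor 2 leaves room for
    this bound to pass to a small perturbation by continuity. *)
Lemma exists_unlikely_bipartition m (A : 'M[R]_m.+2) sd (a : 'I_m.+2)
    (F : {set {set 'I_m.+2}}) (P : {set 'I_m.+2} -> 'M[R]_m.+2) :
  is_graph A -> (0 < #|F|)%N -> (forall S, S \in F -> a \in S) ->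
  (forall S a b, S \in F -> 0 <= P S a b) ->
  (forall S a b, S \in F -> P S a b = P S b a) ->
  (forall S a b, S \in F -> A a b = 0 -> P S a b = 0) ->
  exists S eps, [/\ S \in F, 0 < eps, is_graph (A + eps *: P S) &
    output_law alg (A + eps *: P S) sd [set S; ~: S] <= 2 / #|F|%:R].
Proof.
move=> gA F0 aF P0 Psym PA.
have [S SF lawS] : exists2 S, S \in F &
    output_law alg A sd [set S; ~: S] <= 1 / #|F|%:R.
  apply/exists_inP; apply: contraT => /exists_inPn large.
  have : \sum_(S in F) output_law alg A sd [set S; ~: S] <= 1.
    rewrite -(sum_output_law alg sd gA).
    rewrite -(big_imset (fun C => output_law alg A sd C)
       (h := fun S => [set S; ~: S])) /=.
      rewrite [leRHS](bigID [in [set [set S; ~: S] | S in F]]) /= lerDl.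
      by apply: sumr_ge0 => C _; apply: output_law_ge0.
    (* Distinct members of [F] give distinct bipartitions: both contain [a], so neither is the
       complement of the other. *)
    move=> S T SF TF /setP/(_ S); rewrite !inE eqxx /= => /esym/orP[/eqP//|].
    by move=> /eqP ST; have := aF _ SF; rewrite ST inE aF.
  rewrite leNgt => /negP[].
  have -> : 1 = \sum_(S in F) (1 / #|F|%:R : R).
    by rewrite sumr_const div1r -[RHS]mulr_natr mulVf // pnatr_eq0 -lt0n.
  have [S SF] := card_gt0P F0.
  apply: ltr_sum => [|T TF]; last by rewrite ltNge large.
  by apply/hasP; exists S; rewrite ?mem_index_enum.
(* The harmonic sequence supplies positive values of [eps] that tend to 0. *)
pose u k := A + harmonic k *: P S.
have gu k : is_graph (u k) /\ adjacent (u k) =2 adjacent A.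
  apply: is_graph_perturb => // [x y|x y|x y|].
  - exact: P0.
  - exact: Psym.
  - exact: PA.
  - exact: harmonic_ge0.
have uA : (u @ \oo --> A)%classic.
  apply: cvg_mx => i j; under eq_fun do rewrite !mxE.
  suff : (A i j + harmonic k * P S i j @[k --> \oo] --> A i j + 0 * P S i j)%classic.
    by rewrite mul0r addr0.
  apply: cvgD; first exact: cvg_cst.
  by apply: cvgM; [exact: cvg_harmonic|exact: cvg_cst].
have lt12 : output_law alg A sd [set S; ~: S] < 2 / #|F|%:R.
  apply: le_lt_trans lawS _.
  by rewrite ltr_pM2r ?invr_gt0 ?ltr0n // ltr1n.
have lawu := @cvg_output_law m u A sd [set S; ~: S] gA
  (fun k => (gu k).1) (fun k => (gu k).2) uA.
have [k _ /(_ k (leqnn k)) lek] := cvgr_lt _ lawu _ lt12.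
by exists S, (harmonic k); split=> //; [exact: harmonic_gt0|exact: (gu k).1|exact: ltW].
Qed.

(** Only bipartitions have positive probability, and one with a good side has [S] or its complement
    as a side, hence is [[set S; ~: S]]. At most one term of the sum survives. *)
Lemma sum_output_law_le m (A : 'M[R]_m.+2) sd (good : pred {set 'I_m.+2})
    (S : {set 'I_m.+2}) :
  is_graph A -> (forall T, good T -> T = S \/ T = ~: S) ->
  \sum_(C : {set {set 'I_m.+2}} | [exists T in C, good T]) output_law alg A sd C
    <= output_law alg A sd [set S; ~: S].
Proof.
move=> gA goodS; set C0 := [set S; ~: S].
have law0 (C : {set {set 'I_m.+2}}) : [exists T in C, good T] -> C != C0 ->
    output_law alg A sd C = 0.
  case/exists_inP=> T TC /goodS TS; apply: contraNeq.
  case/output_law_bipartition=> S' CE; rewrite /C0 {}CE !inE in TC *.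
  have [->|->] : S' = S \/ S' = ~: S; last by rewrite setCK setUC.
    case: TS TC => -> /orP[]/eqP E; [left|right|right|left] => //.
      by rewrite E setCK.
    exact: (can_inj (@setCK _)).
  exact: eqxx.
have [good0|bad0] := boolP [exists T in C0, good T].
  by rewrite (bigD1 C0) //= big1 ?addr0 // => C /andP[/law0].
rewrite big1 ?output_law_ge0 // => C gC; apply: law0 => //.
by apply: contraNneq bad0 => <-.
Qed.

End Continuity.

(** * Families of cuts with prescribed vertices on each side *)

Definition extensions (T : finType) (X Y : {set T}) : {set {set T}} :=
  [set X :|: Z | Z in powerset (~: (X :|: Y))].

Lemma extensionsP (T : finType) (X Y S : {set T}) :
  [disjoint X & Y] -> S \in extensions X Y -> X \subset S /\ Y \subset ~: S.
Proof.
move=> dXY /imsetP[Z]; rewrite powersetE => ZXY ->; split; first exact: subsetUl.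
apply/subsetP => y yY; rewrite !inE negb_or; apply/andP; split.
  by apply: contraTN yY => yX; rewrite (disjointFr dXY yX).
by apply: contraL yY => /(subsetP ZXY); rewrite !inE negb_or => /andP[].
Qed.

(** Distinct sets [Z] of free vertices give distinct unions with [X], and at least
    [#|T| - (#|X| + #|Y|)] vertices are free. *)
Lemma card_extensions (T : finType) (X Y : {set T}) :
  (2 ^ (#|T| - (#|X| + #|Y|)) <= #|extensions X Y|)%N.
Proof.
rewrite card_in_imset => [|Z1 Z2]; last first.
  rewrite !powersetE => sZ1 sZ2 eqZ; apply/setP => z.
  have := congr1 (fun Z : {set T} => z \in Z) eqZ; rewrite /= !inE.
  have [zX _|//] := boolP (z \in X).
  have out (Z : {set T}) : Z \subset ~: (X :|: Y) -> z \in Z = false.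
    by move=> sZ; apply/negP => /(subsetP sZ); rewrite !inE zX.
  by rewrite !out.
rewrite card_powerset leq_exp2l // -(cardsC (X :|: Y)) leq_subLR leq_add2r.
by rewrite cardsU leq_subr.
Qed.

(** * Cut weights under perturbation and the general hard instance *)

Section Perturbation.
Variables (R : realType) (n : nat).
Implicit Types (A P : 'M[R]_n) (S T : {set 'I_n}).

Lemma wt_perturb A P (eps : R) S T :
  wt (A + eps *: P) S T = wt A S T + eps * wt P S T.
Proof.
rewrite /wt mulr_sumr -big_split; apply: eq_bigr => a _ /=.
by rewrite mulr_sumr -big_split; apply: eq_bigr => b _; rewrite !mxE.
Qed.

Lemma wt_le0 P S T a b : (forall a b, 0 <= P a b) -> wt P S T <= 0 ->
  a \in S -> b \in T -> P a b = 0.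
Proof.
move=> P0 wt0 aS bT; apply/eqP; rewrite eq_le P0 andbT leNgt.
apply: contraTN wt0 => Pab; rewrite -ltNge wt_gt0 //.
by apply/exists_inP; exists a => //; apply/exists_inP; exists b.
Qed.

End Perturbation.

(** The predicate [optimal] stands for either notion of best cut. Allowing [T = ~: S] covers
    normalized cuts, whose two sides play symmetric roles. *)
Lemma hard_instance (R : realType) (alg : contraction_algorithm R) m
    (A : 'M[R]_m.+2) sd (a : 'I_m.+2) (F : {set {set 'I_m.+2}})
    (P : {set 'I_m.+2} -> 'M[R]_m.+2) (optimal : 'M[R]_m.+2 -> pred {set 'I_m.+2}) :
  continuous_algorithm alg ->
  is_graph A -> (0 < #|F|)%N -> (forall S, S \in F -> a \in S) ->
  (forall S a b, S \in F -> 0 <= P S a b) ->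
  (forall S a b, S \in F -> P S a b = P S b a) ->
  (forall S a b, S \in F -> A a b = 0 -> P S a b = 0) ->
  (forall S eps T, S \in F -> 0 < eps -> optimal (A + eps *: P S) T ->
    T = S \/ T = ~: S) ->
  exists B, is_graph B /\
    \sum_(C : {set {set 'I_m.+2}} | [exists S in C, optimal B S])
      output_law alg B sd C <= 2 / #|F|%:R.
Proof.
move=> hcont gA F0 aF P0 Psym PA opt.
have [S [eps [SF eps0 gB law]]] :=
  exists_unlikely_bipartition hcont sd gA F0 aF P0 Psym PA.
exists (A + eps *: P S); split=> //; apply: le_trans law.
by apply: sum_output_law_le => // T; apply: opt.
Qed.

(** * Minimum s-t-cuts: perturbing the double star *)

Section STMincut.
Variables (R : realType) (m : nat).
Notation s := (ord0 : 'I_m.+2).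
Notation t := (ord_max : 'I_m.+2).

Definition double_star : 'M[R]_m.+2 :=
  \matrix_(a, b) ((a != b) && ((a \in [set s; t]) || (b \in [set s; t])))%:R.

Definition star_perturbation (S : {set 'I_m.+2}) : 'M[R]_m.+2 :=
  \matrix_(a, b) (double_star a b * ((a \in S) == (b \in S))%:R).

Lemma is_graph_double_star : is_graph double_star.
Proof.
have sym a b : double_star a b = double_star b a.
  by rewrite !mxE eq_sym orbC.
split=> // [a b|a|a b]; first by rewrite mxE ler0n.
  by rewrite mxE eqxx.
have conn c : connect (adjacent double_star) c s /\
    connect (adjacent double_star) s c.
  have [->|cs] := eqVneq c s; first by rewrite connect0.
  by split; apply: connect1; rewrite /adjacent ?(sym s) mxE cs !inE eqxx orbT ltr01.
exact: connect_trans (conn a).1 (conn b).2.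
Qed.

Lemma sum_pred1 (X : {set 'I_m.+2}) (x : 'I_m.+2) :
  x \in X -> \sum_(y in X) (y == x)%:R = 1 :> R.
Proof.
move=> xX; rewrite (bigD1 x xX) /= eqxx big1 ?addr0 // => y /andP[_ /negPf ->].
by [].
Qed.

(** On the side of [s], each vertex other than [s] has one cut edge, to [t], while [s] has one to
    every vertex of [~: T]. The total is [#|T| + #|~: T| - 1], whatever [T] is. *)
Lemma cut_cost_double_star (T : {set 'I_m.+2}) :
  s \in T -> t \notin T -> cut_cost double_star T = m.+1%:R.
Proof.
move=> sT tT; have tC : t \in ~: T by rewrite inE.
rewrite /cut_cost /wt.
transitivity (\sum_(a in T) (1 + (a == s)%:R * (#|~: T|%:R - 1) : R)).
  apply: eq_bigr => a aT.
  (* Across the cut the entry is the indicator of [a = s] or [b = t], expanded by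
     inclusion-exclusion. *)
  transitivity (\sum_(b in ~: T)
      ((a == s)%:R + ((b == t)%:R - (a == s)%:R * (b == t)%:R) : R)).
    apply: eq_bigr => b; rewrite inE => bT; rewrite mxE !inE.
    have -> : a == b = false by apply: contraNF bT => /eqP <-.
    have -> : a == t = false by apply: contraNF tT => /eqP <-.
    have -> : b == s = false by apply: contraNF bT => /eqP ->.
    by case: (a == s); case: (b == t) => /=; ring.
  rewrite !big_split /= sumrN -mulr_sumr sum_pred1 // sumr_const.
  by rewrite -[_ *+ #|_|]mulr_natr; ring.
rewrite big_split /= -mulr_suml sum_pred1 // sumr_const mul1r addrA.
by rewrite -natrD cardsC card_ord -natr1 addrK.
Qed.

(** All s-t-cuts tie on the double star, so the perturbation decides. It costs [S] nothing, hence a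
    minimizer [T] cuts no perturbed edge. *)
Lemma star_mincut_unique (S : {set 'I_m.+2}) (eps : R) (T : {set 'I_m.+2}) :
  s \in S -> t \notin S -> 0 < eps ->
  is_st_mincut (double_star + eps *: star_perturbation S) s t T -> T = S.
Proof.
move=> sS tS eps0 /andP[/and3P[_ sT]]; rewrite inE => tT /forallP/(_ S).
have -> /= : is_st_cut s t S.
  rewrite /is_st_cut /is_cut sS inE tS !andbT.
  by apply/andP; split; apply/set0Pn; [exists s|exists t; rewrite inE].
rewrite /cut_cost !wt_perturb -!/(cut_cost _ _) !cut_cost_double_star //.
rewrite lerD2l ler_pM2l // [leRHS]big1 => [P0|a aS]; last first.
  apply: big1 => b; rewrite inE => bS.
  by rewrite mxE aS (negPf bS) mulr0.
have Pge0 a b : 0 <= star_perturbation S a b.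
  by rewrite !mxE mulr_ge0 ?ler0n.
have Pcross a b : a \in T -> b \notin T -> star_perturbation S a b = 0.
  by move=> aT bT; apply: wt_le0 Pge0 P0 aT _; rewrite inE.
(* A vertex of [T] is tested against [t], any other vertex against [s]: an uncut edge of the double
   star must run between the two sides of [S]. *)
apply/setP => x; have [xT|xT] := boolP (x \in T).
  have := Pcross x t xT tT; rewrite !mxE !inE eqxx !orbT.
  have -> : x == t = false by apply: contraNF tT => /eqP <-.
  rewrite mul1r (negPf tS); case: (x \in S) => //= /eqP.
  by rewrite oner_eq0.
have := Pcross s x sT xT; rewrite !mxE !inE eqxx.
have -> : s == x = false by apply: contraNF xT => /eqP <-.
by rewrite mul1r sS; case: (x \in S) => //= /eqP; rewrite oner_eq0.
Qed.

End STMincut.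

(** * Normalized cuts: regular perturbations of the complete graph *)

Section NormalizedCut.
Variables (R : realType) (m : nat).
Implicit Types (S T : {set 'I_m.+2}).

Definition complete_graph : 'M[R]_m.+2 := \matrix_(a, b) (a != b)%:R.

(* The weights inside the two sides of S add 1 to every weighted degree. *)
Definition clique_perturbation S : 'M[R]_m.+2 :=
  \matrix_(a, b) (((a != b) && ((a \in S) == (b \in S)))%:R /
                  #|if a \in S then S else ~: S|.-1%:R).

Lemma is_graph_complete : is_graph complete_graph.
Proof.
split=> [a b|a b|a|a b]; rewrite ?mxE ?ler0n ?eqxx //; first by rewrite eq_sym.
have [->|ab] := eqVneq a b; first exact: connect0.
by apply: connect1; rewrite /adjacent mxE ab ltr01.
Qed.

Lemma clique_perturbation_ge0 S a b : 0 <= clique_perturbation S a b.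
Proof. by rewrite mxE divr_ge0 ?ler0n. Qed.

Lemma clique_perturbation_sym S a b :
  clique_perturbation S a b = clique_perturbation S b a.
Proof.
rewrite !mxE eq_sym [_ == (b \in S)]eq_sym; have [->//|_] := eqVneq (b \in S) (a \in S).
by rewrite andbF !mul0r.
Qed.

Lemma sum_mem (X : {set 'I_m.+2}) : \sum_b (b \in X)%:R = #|X|%:R :> R.
Proof.
rewrite -sum1_card natr_sum [RHS]big_mkcond.
by apply: eq_bigr => b _; case: (b \in X).
Qed.

Lemma complete_degree a : \sum_b complete_graph a b = m.+1%:R.
Proof.
transitivity (\sum_b (b \in [set~ a])%:R : R).
  by apply: eq_bigr => b _; rewrite mxE !inE eq_sym.
by rewrite sum_mem cardsC1 card_ord.
Qed.

(** A vertex has [#|X| - 1] other vertices on its own side [X], each at weight [1 / (#|X| - 1)]. The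
    size hypotheses keep these denominators nonzero. *)
Lemma perturbation_degree S a : (1 < #|S|)%N -> (1 < #|~: S|)%N ->
  \sum_b clique_perturbation S a b = 1.
Proof.
move=> S2 C2; set X := if a \in S then S else ~: S.
have aX : a \in X by rewrite /X; case: ifPn => //; rewrite inE.
have X2 : (1 < #|X|)%N by rewrite /X; case: ifP.
transitivity (\sum_b (b \in X :\ a)%:R / #|X|.-1%:R : R).
  apply: eq_bigr => b _; rewrite mxE !inE eq_sym -/X; congr ((_ && _)%:R / _).
  by rewrite /X; case: (a \in S); rewrite ?inE; case: (b \in S).
rewrite -mulr_suml sum_mem (cardsD1 a X) aX /= divff // pnatr_eq0.
by move: X2; rewrite (cardsD1 a X) aX ltnS -lt0n.
Qed.

Lemma cut_cost_complete T : cut_cost complete_graph T = #|T|%:R * #|~: T|%:R.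
Proof.
rewrite /cut_cost /wt mulr_natl -sumr_const; apply: eq_bigr => a aT.
rewrite -sumr_const; apply: eq_bigr => b; rewrite inE => bT.
by rewrite mxE; case: eqP aT bT => // -> ->.
Qed.

(** The perturbed graph is regular of degree [d], so [ncut] is a constant plus a positive multiple
    of the perturbation cost. That cost is 0 at [S], so it is 0 at any minimizer [T], and [T] must
    separate exactly as [S] does. *)
Lemma clique_normalized_cut S (eps : R) T :
  (1 < #|S|)%N -> (1 < #|~: S|)%N -> 0 < eps ->
  is_normalized_cut (complete_graph + eps *: clique_perturbation S) T ->
  T = S \/ T = ~: S.
Proof.
move=> S2 C2 eps0 /andP[/andP[T0 TC0] /forallP/(_ S)].
have -> /= : is_cut S.
  by rewrite /is_cut -!card_gt0 !(ltn_trans _ S2) ?(ltn_trans _ C2).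
pose d : R := m.+1%:R + eps.
have d0 : 0 < d by rewrite addr_gt0 ?ltr0n.
have vol X : wt (complete_graph + eps *: clique_perturbation S) X [set: 'I_m.+2]
    = #|X|%:R * d.
  rewrite mulr_natl -sumr_const; apply: eq_bigr => a _.
  rewrite (eq_bigl xpredT) => [|b]; last by rewrite inE.
  rewrite /d -(complete_degree a).
  rewrite -[eps in RHS]mulr1 -(perturbation_degree a S2 C2) mulr_sumr -big_split.
  by apply: eq_bigr => b _; rewrite !mxE.
have ncutE X : X != finset.set0 -> ~: X != finset.set0 ->
    ncut (complete_graph + eps *: clique_perturbation S) X =
    m.+2%:R / d + eps * cut_cost (clique_perturbation S) X *
      ((#|X|%:R * d)^-1 + (#|~: X|%:R * d)^-1).
  rewrite -!card_gt0 => X0 XC0; rewrite /ncut !vol /cut_cost wt_perturb.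
  rewrite -!/(cut_cost _ _) cut_cost_complete.
  (* The complete-graph part contributes [(#|X| + #|~: X|) / d], which does not depend on [X]. *)
  have -> : m.+2%:R = #|X|%:R + #|~: X|%:R :> R by rewrite -natrD cardsC card_ord.
  by field; rewrite ?gt_eqF ?ltr0n.
have S0 : S != finset.set0 by rewrite -card_gt0 (ltn_trans _ S2).
have SC0 : ~: S != finset.set0 by rewrite -card_gt0 (ltn_trans _ C2).
rewrite !ncutE // lerD2l.
have -> : cut_cost (clique_perturbation S) S = 0.
  apply: big1 => a aS; apply: big1 => b; rewrite inE => bS.
  by rewrite mxE aS (negPf bS) andbF mul0r.
rewrite mulr0 mul0r pmulr_lle0; last first.
  by rewrite addr_gt0 // invr_gt0 mulr_gt0 // ltr0n card_gt0.
rewrite pmulr_rle0 // => P0.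
have cross a b : a \in T -> b \notin T -> (a \in S) != (b \in S).
  move=> aT bT; have := wt_le0 (@clique_perturbation_ge0 S) P0 aT.
  move=> /(_ b); rewrite inE bT => /(_ isT) /eqP; rewrite mxE.
  have ab : a != b by apply: contraNneq bT => <-.
  rewrite ab /=; apply: contraTN => /eqP ->; rewrite eqxx mul1r invr_eq0 pnatr_eq0.
  by rewrite -lt0n; case: ifP => _; rewrite -subn1 subn_gt0.
have /set0Pn[x xT] := T0; have /set0Pn[y] := TC0; rewrite inE => yT.
have xy := cross x y xT yT.
(* Vertices separated by [T] lie on opposite sides of [S]. Comparing [z] with [y] or with [x]
   therefore determines its side. *)
have TE z : (z \in T) = ((z \in S) == (x \in S)).
  have [zT|zT] := boolP (z \in T).
    by have := cross z y zT yT; move: xy; do 3!case: (_ \in S).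
  by have := cross x z xT zT; do 2!case: (_ \in S).
have [xS|xS] := boolP (x \in S); [left|right]; apply/setP => z.
  by rewrite TE xS eqb_id.
by rewrite TE (negPf xS) eqbF_neg inE.
Qed.

End NormalizedCut.

(** * Exponential bounds and assembly of the two families *)

Lemma sum_output_law_le1 (R : realType) (alg : contraction_algorithm R) m
    (A : 'M[R]_m.+2) sd (Q : pred {set {set 'I_m.+2}}) :
  is_graph A -> \sum_(C | Q C) output_law alg A sd C <= 1.
Proof.
move=> gA; rewrite -(sum_output_law alg sd gA) [leRHS](bigID Q) /= lerDl.
by apply: sumr_ge0 => C _; apply: output_law_ge0.
Qed.

(** Here [k] counts the free vertices and [c] the prescribed ones, so the exponent [k + c] is the
    number of vertices and the loss [2 ^+ c] goes into the constant. *)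
Lemma two_div_le (R : realType) (k c f : nat) :
  (2 ^ k <= f)%N -> 2 / f%:R <= 2 ^+ c.+1 * (1 / 2) ^+ (k + c) :> R.
Proof.
move=> kf; apply: (@le_trans _ _ (2 / 2 ^+ k)).
  rewrite ler_pM2l // lef_pV2 ?posrE ?exprn_gt0 ?ltr0n //.
    by rewrite -natrX ler_nat.
  by apply: leq_trans kf; rewrite expn_gt0.
have -> : 2 ^+ c.+1 * (1 / 2) ^+ (k + c) = 2 / 2 ^+ k :> R.
  by rewrite expr_div_n expr1n exprS exprD; field; rewrite !expf_neq0 ?pnatr_eq0.
exact: lexx.
Qed.

Unset Implicit Arguments.

Theorem theorem2 (R : realType) (alg : contraction_algorithm R)
    (hcont : continuous_algorithm alg) :
  (exists (G : forall n : nat, 'M[R]_n.+2) (s t : forall n : nat, 'I_n.+2),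
     (forall n : nat, is_graph (G n) /\ s n <> t n) /\
     (exists C c : R, [/\ 0 < c, c < 1 &
        forall n : nat,
          prob_st_mincut alg (G n) (s n) (t n) <= C * c ^+ n.+2]))
  /\
  (exists G : forall n : nat, 'M[R]_n.+2,
     (forall n : nat, is_graph (G n)) /\
     (exists C c : R, [/\ 0 < c, c < 1 &
        forall n : nat,
          prob_normalized_cut alg (G n) <= C * c ^+ n.+2])).
Proof.
have half0 : 0 < 1 / 2 :> R by rewrite divr_gt0.
have half1 : 1 / 2 < 1 :> R by rewrite ltr_pdivrMr ?mul1r ?ltr1n.
split.
  have ex n : exists G : 'M[R]_n.+2, is_graph G /\
      prob_st_mincut alg G ord0 ord_max <= 2 ^+ 3 * (1 / 2) ^+ n.+2.
    (* Only the two seeds are prescribed, which leaves [n] free vertices out of [n.+2]. *)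
    pose F := extensions [set ord0 : 'I_n.+2] [set ord_max].
    have cardF : (2 ^ n <= #|F|)%N.
      by apply: leq_trans (card_extensions _ _); rewrite !cards1 card_ord subn2.
    have FP S : S \in F -> ord0 \in S /\ ord_max \notin S.
      case/extensionsP; first by rewrite disjoints1 inE.
      by rewrite !sub1set inE.
    have [||S /FP[]|S a b _|S a b _|S a b _|S eps T /FP[sS tS] eps0|B [gB lawB]] :=
      @hard_instance R alg n (double_star R n) (Some (ord0, ord_max)) ord0 F
        (@star_perturbation R n) (fun B => is_st_mincut B ord0 ord_max) hcont.
    - exact: is_graph_double_star.
    - by apply: leq_trans cardF; rewrite expn_gt0.
    - by [].
    - by rewrite !mxE mulr_ge0 ?ler0n.
    - by rewrite !mxE eq_sym orbC [(a \in S) == _]eq_sym.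
    - by move=> A0; rewrite mxE A0 mul0r.
    - by move=> opt; left; apply: star_mincut_unique opt.
    exists B; split=> //; apply: le_trans lawB _.
    by have := @two_div_le R _ 2 _ cardF; rewrite addn2.
  (* Choice turns the existence of one graph for each [n] into a family. *)
  pose GP n := svalP (cid (ex n)).
  exists (fun n => sval (cid (ex n))), (fun=> ord0), (fun=> ord_max); split=> [n|].
    by split; [exact: (GP n).1|].
  by exists (2 ^+ 3), (1 / 2); split=> // n; exact: (GP n).2.
have ex n : exists G : 'M[R]_n.+2, is_graph G /\
    prob_normalized_cut alg G <= 2 ^+ 5 * (1 / 2) ^+ n.+2.
  (* Two or three vertices do not allow two sides of size at least 2. Here the claimed bound is at
     least 1, since [n.+2] is at most 5, and any graph will do. *)
  have [n2|n2] := ltnP n 2.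
    exists (complete_graph R n); split; first exact: is_graph_complete.
    apply: le_trans (sum_output_law_le1 _ _ _ (is_graph_complete R n)) _.
    rewrite expr_div_n expr1n mulrA mulr1 ler_pdivlMr ?exprn_gt0 // mul1r.
    by rewrite ler_eXn2l ?ltr1n // -addn2 (leq_trans (leq_add (ltnW n2) (leqnn 2))).
  case: n n2 => [|[|n]] // _.
  (* Prescribing two vertices on each side guarantees the sizes that the regular perturbation needs,
     and [n] of the [n.+4] vertices stay free. *)
  pose F := extensions [set inord 0; inord 1 : 'I_n.+4] [set inord 2; inord 3].
  have cardF : (2 ^ n <= #|F|)%N.
    apply: leq_trans (card_extensions _ _); rewrite leq_exp2l // card_ord !cards2.
    by do 2!case: (_ != _) => /=; rewrite !subSS ?subn0 ?leq_subr // leqW ?leqW.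
  have FP S : S \in F -> [/\ inord 0 \in S, (1 < #|S|)%N & (1 < #|~: S|)%N].
    case/extensionsP => [|sub1 sub2].
      rewrite disjoint_subset; apply/subsetP => x; rewrite !inE => /orP[]/eqP ->.
        by rewrite -!val_eqE /= !inordK.
      by rewrite -!val_eqE /= !inordK.
    split.
    - by apply: (subsetP sub1); rewrite !inE eqxx.
    - apply: leq_trans (subset_leq_card sub1).
      by rewrite cards2 -val_eqE /= !inordK.
    - apply: leq_trans (subset_leq_card sub2).
      by rewrite cards2 -val_eqE /= !inordK.
  have [||S /FP[]|S a b _|S a b _|S a b _|S eps T /FP[_ S2 C2] eps0|B [gB lawB]] :=
    @hard_instance R alg n.+2 (complete_graph R n.+2) None (inord 0) F
      (@clique_perturbation R n.+2) (@is_normalized_cut R _) hcont.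
  - exact: is_graph_complete.
  - by apply: leq_trans cardF; rewrite expn_gt0.
  - by [].
  - exact: clique_perturbation_ge0.
  - exact: clique_perturbation_sym.
  - by rewrite !mxE; case: eqP => [|_ /eqP]; rewrite ?oner_eq0 ?mul0r.
  - exact: clique_normalized_cut.
  exists B; split=> //; apply: le_trans lawB _.
  by have := @two_div_le R _ 4 _ cardF; rewrite addn4.
pose GP n := svalP (cid (ex n)).
exists (fun n => sval (cid (ex n))); split=> [n|]; first exact: (GP n).1.
by exists (2 ^+ 5), (1 / 2); split=> // n; exact: (GP n).2.
Qed.
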